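(* Let $M\ge1$ be an integer and let $X_{iso}:=\{x\in(0,\infty):\mathcal{U}(x)\text{ contains isolated points}\}$. For any $x\in[0,1]$ and any $\delta>0$ the intersection $X_{iso}\cap(x-\delta,x+\delta)$ contains an interval.
   Context: For $q\in(1,M+1]$ and $x\ge0$, a $q$-expansion of $x$ is a sequence $(d_i)_{i\ge1}\in\{0,1,\ldots,M\}^{\mathbb{N}}$ with $x=\sum_{i\ge1}d_iq^{-i}$. $\mathcal{U}(x)$ is the set of $q\in(1,M+1]$ such that $x$ has exactly one $q$-expansion. An isolated point of $\mathcal{U}(x)$ is a point $p\in\mathcal{U}(x)$ with $\mathcal{U}(x)\cap(p-\varepsilon,p+\varepsilon)=\{p\}$ for some $\varepsilon>0$. ''Interval'' means a non-degenerate interval (non-empty open interval). *)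

(* Defs.v *)
From HB Require Import structures.
From mathcomp Require Import all_boot all_order all_algebra.
From mathcomp Require Import all_classical all_reals all_analysis.
Import Order.TTheory GRing.Theory Num.Theory.
Import numFieldNormedType.Exports.

Set Implicit Arguments.
Unset Strict Implicit.
Unset Printing Implicit Defensive.

Local Open Scope classical_set_scope.
Local Open Scope ring_scope.

(* Digits are indexed from 0: [d i] is the digit d_(i+1), of weight q^-(i+1). *)
Definition q_expansion (R : realType) (M : nat) (q x : R)
    (d : nat -> 'I_M.+1) : Prop :=
  [series (d i : nat)%:R / q ^+ i.+1]_i @ \oo --> x.

Definition univoque_bases (R : realType) (M : nat) (x : R) : set R :=
  [set q | 1 < q <= M.+1%:R /\ exists! d : nat -> 'I_M.+1, q_expansion q x d].

Definition X_iso (R : realType) (M : nat) : set R :=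
  [set x | 0 < x /\ isolated (univoque_bases M x) !=set0].

Arguments X_iso R M : clear implicits.

(* Main.v *)
(* Write r_0 = y, r_(i+1) = q r_i - d_i for the remainders of a digit sequence d.
   It is a q-expansion of y iff all r_i lie in [0, K], K = M/(q-1), and it is the
   only one iff moreover r_(i+1) < 1 when d_i < M and r_(i+1) > K - 1 when d_i > 0.
   Take d = w 0 (M^n 0^n)^oo with w a prefix, shorter than n, of an (M+1)-expansion
   of x. For q in some open window close to M+1, d is the unique expansion of its
   value g(q), and every unique expansion in a base of the window that starts with
   w 0 M^n must continue with 0^n, then M^n, and so on, hence equals d. By continuity
   of the remainders in q, the unique expansion of y = g(q) in a base q' close to q
   starts with w 0 M^n, so it is d, and q' = q because the value of d determines the
   base. Thus q is isolated in U(g(q)), and g maps the window onto a set containing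
   an interval, which is near x when q is near M+1 and w is long. *)
Require Import Defs.
From HB Require Import structures.
From mathcomp Require Import all_boot all_order all_algebra.
From mathcomp Require Import all_classical all_reals all_analysis.
From mathcomp Require Import zify ring lra.
Import Order.TTheory GRing.Theory Num.Theory.
Import numFieldNormedType.Exports.
Local Open Scope classical_set_scope.
Local Open Scope ring_scope.

Lemma expr_unbounded (R : realType) (q B : R) : 1 < q ->
  exists N, forall n, (N <= n)%N -> B < q ^+ n.
Proof.
move=> q1.
have bern n : 1 + n%:R * (q - 1) <= q ^+ n.
  elim: n => [|n IHn]; first by rewrite expr0 mul0r addr0.
  rewrite exprS -natr1.
  have n0 : 0 <= n%:R :> R := ler0n _ _.
  have := sqr_ge0 (q - 1); nra.
exists (Num.bound `|B / (q - 1)|) => n Nn.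
apply: lt_le_trans (bern n).
have q10 : 0 < q - 1 by rewrite subr_gt0.
have Bn : B / (q - 1) < n%:R.
  apply: le_lt_trans (ler_norm _) _.
  by apply: lt_le_trans (archi_boundP (normr_ge0 _)) _; rewrite ler_nat.
by move: Bn; rewrite ltr_pdivrMr//; lra.
Qed.

(** * Remainders and uniqueness of expansions *)

Section Remainders.
Context {R : realType} {M : nat}.
Implicit Types (q x : R) (d e : nat -> 'I_M.+1).

Fixpoint remainder q x d n : R :=
  if n is k.+1 then q * remainder q x d k - (d k : nat)%:R else x.

(* The largest number with a [q]-expansion. *)
Definition top q : R := M%:R / (q - 1).

Definition psum q d n : R := \sum_(0 <= i < n) (d i : nat)%:R / q ^+ i.+1.

Lemma topM q : 1 < q -> q * top q - M%:R = top q.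
Proof. by move=> q1; rewrite /top; field; rewrite subr_eq0 gt_eqF. Qed.

Lemma top_ge1 q : 1 < q <= M.+1%:R -> 1 <= top q.
Proof.
by case/andP=> q1; rewrite /top ler_pdivlMr ?subr_gt0// mul1r -natr1; lra.
Qed.

Lemma top_gt1 q : 1 < q < M.+1%:R -> 1 < top q.
Proof.
by case/andP=> q1; rewrite /top ltr_pdivlMr ?subr_gt0// mul1r -natr1; lra.
Qed.

Lemma digit_le d i : (d i : nat)%:R <= M%:R :> R.
Proof. by rewrite ler_nat -ltnS. Qed.

Lemma remainderE q x d n : q != 0 ->
  remainder q x d n = q ^+ n * (x - psum q d n).
Proof.
move=> q0; elim: n => [|n IHn] /=; first by rewrite /psum big_geq// expr0 mul1r subr0.
rewrite IHn /psum big_nat_recr//= exprS.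
by field; rewrite q0 expf_neq0.
Qed.

Lemma psumE q x d n : q != 0 -> psum q d n = x - remainder q x d n / q ^+ n.
Proof. by move=> q0; rewrite remainderE//; field; rewrite expf_neq0. Qed.

Lemma remainder_eq q x d e n : (forall i, (i < n)%N -> d i = e i) ->
  remainder q x d n = remainder q x e n.
Proof.
elim: n => //= n IHn de; rewrite IHn; first by rewrite (de n).
by move=> i /ltnW; exact: de.
Qed.

Lemma remainder_add q x d m n :
  remainder q x d (m + n) = remainder q (remainder q x d m) (fun i => d (m + i)%N) n.
Proof. by elim: n => [|n IHn]; rewrite ?addn0// addnS/= IHn. Qed.

(** By [remainderE] the bounds say [psum q d n <= x <= psum q d n + top q / q ^+ n]. In [n] the left
    side never decreases, the right side never increases by [topM], and their gap tends to 0. *)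
Lemma q_expansionP q x d : 1 < q ->
  q_expansion q x d <-> forall n, 0 <= remainder q x d n <= top q.
Proof.
move=> q1; have q0 : q != 0 by rewrite gt_eqF//; lra.
have qn0 n : 0 < q ^+ n by apply: exprn_gt0; lra.
have cvgX0 : (fun n => top q / q ^+ n) @ \oo --> 0.
  have -> : (fun n => top q / q ^+ n) = geometric (top q) q^-1.
    by apply/funext => n; rewrite /geometric/= exprVn.
  apply: cvg_geometric; rewrite normfV ger0_norm ?invf_lt1//; lra.
have seriesE n : [series (d i : nat)%:R / q ^+ i.+1]_i n = psum q d n by [].
split=> [dx n | bnd].
  have nd : {homo psum q d : m n / (m <= n)%N >-> m <= n}.
    apply/nondecreasing_seqP => k; rewrite /psum big_nat_recr//= lerDl.
    by rewrite divr_ge0// ltW.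
  have px : psum q d n <= x.
    apply: (cvgr_to_ge dx).
    by exists n => // k /=; exact: nd.
  have ni : {homo (fun n => psum q d n + top q / q ^+ n) : m n / (m <= n)%N >-> n <= m}.
    apply/nonincreasing_seqP => k; rewrite /psum big_nat_recr//= -addrA lerD2l.
    rewrite -mulrDl exprS invfM mulrA ler_pM2r ?invr_gt0//.
    rewrite ler_pdivrMr ?(lt_trans _ q1)//.
    have := topM _ q1; have := digit_le d k; lra.
  have xp : x <= psum q d n + top q / q ^+ n.
    have lim : (fun n => psum q d n + top q / q ^+ n) @ \oo --> x.
      by rewrite -[x]addr0; apply: cvgD => //; exact: dx.
    apply: (cvgr_to_le lim).
    by exists n => // k /=; exact: ni.
  rewrite remainderE//; apply/andP; split.
    by apply: mulr_ge0; [exact: ltW|rewrite subr_ge0].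
  by rewrite mulrC -ler_pdivlMr//; lra.
rewrite /q_expansion (_ : [series _]_i = psum q d)//.
suff : (fun n => x - psum q d n) @ \oo --> 0.
  move=> h.
  have : (fun n => x - (x - psum q d n)) @ \oo --> x - 0.
    by apply: cvgB => //; exact: cvg_cst.
  rewrite subr0 (_ : (fun n => _) = psum q d)//.
  by apply/funext => n; rewrite subKr.
apply: (@squeeze_cvgr _ _ _ _ (cst 0) (fun n => top q / q ^+ n)) => //; last exact: cvg_cst.
near=> n; rewrite (@psumE _ x)// subKr.
have /andP[h1 h2] := bnd n.
by rewrite /= divr_ge0 ?(ltW (qn0 _))//= ler_pM2r ?invr_gt0.
Unshelve. all: by end_near. Qed.

(* If [e] first departs from [d] at [i], its next remainder is that of [d] shifted
   by an integer [>= 1] towards the outside of [[0, top q]]. *)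
Lemma expansion_prefix_unique q x d e N : 1 < q ->
  (forall n, 0 <= remainder q x e n <= top q) ->
  (forall i, (i < N)%N -> (d i < M)%N -> remainder q x d i.+1 < 1) ->
  (forall i, (i < N)%N -> (0 < d i)%N -> top q - 1 < remainder q x d i.+1) ->
  forall i, (i < N)%N -> e i = d i.
Proof.
move=> q1 be hlt hgt; elim/ltn_ind => i IH iN.
have eqr : remainder q x e i = remainder q x d i.
  by apply: remainder_eq => j ji; apply: IH => //; exact: ltn_trans iN.
have /andP[h0 h1] := be i.+1.
move: h0 h1 (hlt i iN) (hgt i iN) => /=; rewrite eqr.
have := ltn_ord (e i); have := ltn_ord (d i); rewrite !ltnS => dM eM.
move=> h0 h1 h2 h3.
apply: val_inj => /=; case: (ltngtP (e i) (d i)) => // ed.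
- have := h3 (leq_ltn_trans (leq0n _) ed).
  have : (e i).+1%:R <= (d i : nat)%:R :> R by rewrite ler_nat.
  by rewrite -natr1 => ? ?; exfalso; lra.
- have := h2 (leq_trans ed eM).
  have : (d i).+1%:R <= (e i : nat)%:R :> R by rewrite ler_nat.
  by rewrite -natr1 => ? ?; exfalso; lra.
Qed.

(** The largest digit [c <= q * x] works: if [c < M] it leaves a remainder [< 1 <= top q], and if
    [c = M] the fixed point equation [topM] gives the bound. *)
Lemma greedy_digit q x : 1 < q <= M.+1%:R -> 0 <= x <= top q ->
  exists c : 'I_M.+1, 0 <= q * x - (c : nat)%:R <= top q.
Proof.
move=> /andP[q1 qM] /andP[x0 xt].
have K1 : 1 <= top q by apply: top_ge1; rewrite q1.
have qx0 : 0 <= q * x by rewrite mulr_ge0//; lra.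
have P0 : ((@ord0 M : nat)%:R <= q * x) by [].
case: (@arg_maxnP _ ord0 (fun c : 'I_M.+1 => (c : nat)%:R <= q * x)
  (fun c : 'I_M.+1 => c : nat) P0).
move=> c cx cmax; exists c; rewrite subr_ge0 cx/=.
have [cM|cM] := ltnP c M; last first.
  have : M%:R <= (c : nat)%:R :> R by rewrite ler_nat.
  have := topM _ q1; nra.
rewrite leNgt; apply/negP => big.
have := cmax (Ordinal (cM : (c.+1 < M.+1)%N)) => /=; rewrite -natr1 ltnn => H.
by have := H ltac:(lra).
Qed.

Lemma expansion_exists q x : 1 < q <= M.+1%:R -> 0 <= x <= top q ->
  exists d, forall n, 0 <= remainder q x d n <= top q.
Proof.
move=> hq hx.
(* Outside [[0, top q]] the digit is an arbitrary [ord0]; the iteration from [x] never gets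
   there. *)
have /choice[c cP] (y : R) : exists c : 'I_M.+1,
    0 <= y <= top q -> 0 <= q * y - (c : nat)%:R <= top q.
  have [/greedy_digit-/(_ hq)[c cP]|ny] := pselect (0 <= y <= top q); first by exists c.
  by exists ord0.
pose y n := iter n (fun y => q * y - (c y : nat)%:R) x.
exists (fun n => c (y n)) => n.
suff <- : y n = remainder q x (fun n => c (y n)) n by elim: n => //= n /cP.
by elim: n => //= n ->.
Qed.

(** Raising or lowering digit [i] by one shifts the next remainder by -1 or +1; the two bounds put
    the result outside [[0, top q]]. *)
Definition univoque_digit q x d i :=
  ((d i < M)%N -> remainder q x d i.+1 < 1) /\
  ((0 < d i)%N -> top q - 1 < remainder q x d i.+1).

(** If a bound failed at [i], a neighbouring digit would leave a remainder in [[0, top q]], and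
    expanding that remainder would give a second expansion of [x]. *)
Lemma unique_univoque_digit q x d : 1 < q <= M.+1%:R ->
  q_expansion q x d -> (forall e, q_expansion q x e -> d = e) ->
  forall i, univoque_digit q x d i.
Proof.
move=> hq /q_expansionP dx dU i; have q1 : 1 < q by case/andP: hq.
have K1 : 1 <= top q := top_ge1 _ hq.
have {}dx := dx q1.
have replace (c : 'I_M.+1) : c != d i ->
    ~ (0 <= q * remainder q x d i - (c : nat)%:R <= top q).
  move=> cd /(expansion_exists _ _ hq)[f fP].
  pose e j := if (j < i)%N then d j else if j == i then c else f (j - i.+1)%N.
  have ei : remainder q x e i = remainder q x d i.
    by apply: remainder_eq => j ji; rewrite /e ji.
  have eiE : e i = c by rewrite /e ltnn eqxx.
  have : d = e.
    apply: dU; apply/q_expansionP => // n.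
    case: (leqP n i) => ni.
      suff -> : remainder q x e n = remainder q x d n by exact: dx.
      by apply: remainder_eq => j jn; rewrite /e (leq_trans jn ni).
    rewrite -(subnKC ni) remainder_add/= ei eiE.
    rewrite (_ : (fun k => e (i.+1 + k)%N) = f) ?fP//.
    by apply/funext => k; rewrite /e ltnNge leqW ?leq_addr//= gtn_eqF ?addKn// ltnS leq_addr.
  by move=> /(congr1 (fun h => h i)); rewrite eiE => dc; rewrite -dc eqxx in cd.
have /andP[h0 h1] := dx i.+1; split => dM.
  rewrite ltNge; apply/negP => r1.
  apply: (replace (Ordinal (dM : ((d i).+1 < M.+1)%N))).
    by rewrite -val_eqE/= gtn_eqF.
  move: h1 r1 => /=; rewrite -natr1 => h1 r1.
  by apply/andP; split; lra.
rewrite ltNge; apply/negP => r1.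
have dM' : ((d i).-1 < M.+1)%N by apply: leq_ltn_trans (leq_pred _) (ltn_ord _).
apply: (replace (Ordinal dM')).
  by rewrite -val_eqE/= ltn_eqF// prednK.
move: h0 r1 => /=; have -> : (d i : nat)%:R = (d i).-1%:R + 1 :> R.
  by rewrite natr1 prednK.
by move=> h0 r1; apply/andP; split; lra.
Qed.

End Remainders.

Arguments top {R} M q.

(** * Alternating blocks of maximal and zero digits *)

Section BlockSequences.
Context {R : realType} {M : nat}.
Implicit Types (q x y : R) (e : nat -> 'I_M.+1).

(* The third bound says that (M^n 0^n)^oo represents a number [< 1], the fourth that
   a remainder [< 1] whose digits start with M^n continues with 0^n. *)
Definition block_window n q : Prop :=
  [/\ 1 < q, q < M.+1%:R, q ^+ n * (top M q - 1) < 1 &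
      top M q * (q ^+ n - 1) < q ^+ n ^+ 2 * (top M q - 1)].

(* The digits of (M^n 0^n)^oo; [block_value] is the number they represent. *)
Definition block n k : 'I_M.+1 := if odd (k %/ n) then ord0 else ord_max.

Definition block_value n q : R := top M q * q ^+ n / (q ^+ n + 1).

(** The 0 at index [L] makes the first block start with a remainder [< 1], as [block_forced]
    requires. *)
Definition block_tail e L n i : 'I_M.+1 :=
  if (i < L)%N then e i else if i == L then ord0 else block n (i - L.+1).

Lemma geometric_run q (s : nat -> R) n :
  (forall j, (j < n)%N -> s j.+1 = q * s j) ->
  forall j, (j <= n)%N -> s j = q ^+ j * s 0%N.
Proof.
move=> H; elim=> [|j IHj] jn; first by rewrite expr0 mul1r.
by rewrite H// IHj ?(ltnW jn)// exprS mulrA.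
Qed.

(* A block M^n whose remainder at the start is < 1 brings the remainder so close
   to 0 that no positive digit can occur in the next n places. *)
Lemma block_step q K m n (r c : nat -> R) : 1 < q -> 1 < K -> q * K - m = K ->
  (forall i, r i.+1 = q * r i - c i) ->
  (forall i, c i = 0 \/ 1 <= c i /\ K - 1 < r i.+1) ->
  K * (q ^+ n - 1) < q ^+ n ^+ 2 * (K - 1) ->
  (forall j, (j < n)%N -> c j = m) -> r 0%N < 1 ->
  forall j, (j < n)%N -> c (n + j)%N = 0.
Proof.
move=> q1 K1 Km rS cP hu cm r0.
have u1 : 1 <= q ^+ n by apply: exprn_ege1; lra.
(* A digit [m] multiplies the distance to the fixed point [K] by [q]. *)
have Krn : K - r n = q ^+ n * (K - r 0%N).
  apply: (geometric_run q (fun j => K - r j) n) => // j jn.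
  by rewrite rS cm//; lra.
elim/ltn_ind => j IH jn.
case: (cP (n + j)%N) => // -[c1 cr]; exfalso.
have rnj : r (n + j)%N = q ^+ j * r n.
  rewrite -[in RHS](addn0 n).
  apply: (geometric_run q (fun k => r (n + k)%N) j) => // k kj.
  by rewrite addnS rS IH ?subr0// (ltn_trans kj).
move: cr; rewrite rS rnj mulrCA mulrA -exprSr => cr.
(* A first nonzero digit at [n + j] thus needs [K < q ^+ n * r n], while [r 0 < 1] bounds
   [q ^+ n * r n] by a quantity that [hu] puts below [K]. *)
have Kr : K < q ^+ j.+1 * r n by lra.
have qj0 : 0 < q ^+ j.+1 by apply: exprn_gt0; lra.
have rn0 : 0 < r n by rewrite -(pmulr_rgt0 _ qj0); lra.
have : q ^+ j.+1 * r n <= q ^+ n * r n by rewrite ler_pM2r// ler_eXn2l.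
have : q ^+ n * r n < q ^+ n * (K - q ^+ n * (K - 1)).
  rewrite ltr_pM2l; last lra.
  have : q ^+ n * (K - 1) < q ^+ n * (K - r 0%N) by rewrite ltr_pM2l; lra.
  lra.
rewrite !expr2 in hu *; nra.
Qed.

(** Induction on blocks: the last digit of a block gives the bound on the next starting remainder,
    and [block_step] then yields the digits of the next block. *)
Lemma block_forced q x e m n : (0 < M)%N -> (0 < n)%N -> block_window n q ->
  (forall i, univoque_digit q x e i) -> remainder q x e m < 1 ->
  (forall j, (j < n)%N -> e (m + j)%N = ord_max) ->
  forall k, e (m + k)%N = block n k.
Proof.
move=> M0 n0 [q1 qM hu1 hu2] eb rm em.
have K1 : 1 < top M q by apply: top_gt1; rewrite q1.
have Km := topM (M := M) _ q1.
pose P b := if odd b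
  then top M q - 1 < remainder q x e (m + b * n) /\
       (forall j, (j < n)%N -> e (m + b * n + j)%N = ord0)
  else remainder q x e (m + b * n) < 1 /\
       (forall j, (j < n)%N -> e (m + b * n + j)%N = ord_max).
suff Pb b : P b.
  move=> k; rewrite /block {1}(divn_eq k n) addnA.
  have := Pb (k %/ n)%N; rewrite /P; case: ifP => _ [_]; apply; exact: ltn_pmod.
elim: b => [|b]; first by rewrite /P/= mul0n addn0.
rewrite /P /= mulSnr addnA.
set k0 := (m + b * n)%N.
have last : (k0 + n = (k0 + n.-1).+1)%N by rewrite -addnS prednK.
have n1 : (n.-1 < n)%N by rewrite prednK.
have [_|_] := boolP (odd b) => /= -[rk ek]; split.
- by rewrite last; apply: (eb _).1; rewrite ek.
(* From 0^n to M^n, [block_step] is applied to the reflected remainders [top M q - r] and digits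
   [M - d]. *)
- have H := @block_step q (top M q) M%:R n
    (fun i => top M q - remainder q x e (k0 + i))
    (fun i => M%:R - (e (k0 + i)%N : nat)%:R) q1 K1 Km _ _ hu2 _ _.
  move=> j jn; apply: val_inj => /=.
  have : M%:R - (e (k0 + (n + j))%N : nat)%:R = 0 :> R.
    apply: H jn => [i|i|i ni|].
    + by rewrite addnS/=; lra.
    + have [ge|lt] := leqP M (e (k0 + i)%N).
        left; apply/eqP; rewrite subr_eq0 eqr_nat eqn_leq ge/=.
        by rewrite -ltnS.
      right; split.
        have : (e (k0 + i)%N).+1%:R <= M%:R :> R by rewrite ler_nat.
        by rewrite -natr1; lra.
      by rewrite addnS; have := (eb (k0 + i)%N).1 lt; lra.
    + by rewrite ek//= subr0.
    + by rewrite addn0; lra.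
  by move/eqP; rewrite subr_eq0 eqr_nat addnA => /eqP.
- by rewrite last; apply: (eb _).2; rewrite ek.
- have H := @block_step q (top M q) M%:R n
    (fun i => remainder q x e (k0 + i)%N)
    (fun i => (e (k0 + i)%N : nat)%:R) q1 K1 Km _ _ hu2 _ _.
  move=> j jn; apply: val_inj => /=.
  have : (e (k0 + (n + j))%N : nat)%:R = 0 :> R.
    apply: H jn => [i|i|i ni|].
    + by rewrite addnS.
    + have [e0|lt] := posnP (e (k0 + i)%N); first by left; rewrite e0.
      right; split; first by rewrite ler1n.
      by rewrite addnS; have := (eb (k0 + i)%N).2 lt.
    + by rewrite ek.
    + by rewrite addn0.
  by move/eqP; rewrite pnatr_eq0 addnA => /eqP.
Qed.

(** Let v = [top M q / (q ^+ n + 1)]. Digits 0 multiply the remainder by [q], digits [M] its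
    distance to the top; the pattern closes up because [q ^+ n] v = [top M q] - v. The case [j = n]
    is also the start of the next block. *)
Lemma block_remainder n q b j : (0 < n)%N -> 1 < q -> (j <= n)%N ->
  remainder q (block_value n q) (block n) (b * n + j) =
  if odd b then q ^+ j * (top M q / (q ^+ n + 1))
  else top M q - q ^+ j * (top M q / (q ^+ n + 1)).
Proof.
move=> n0 q1; have Km := topM (M := M) _ q1.
have u1 : q ^+ n + 1 != 0 by rewrite gt_eqF// ltr_wpDl// exprn_ge0//; lra.
elim: b j => [|b IHb] j jn.
  rewrite mul0n add0n/=.
  elim: j jn => [|j IHj] jn /=; first by rewrite expr0 /block_value; field.
  rewrite IHj ?(ltnW jn)// /block divn_small//= exprS; lra.
have base : remainder q (block_value n q) (block n) (b.+1 * n) =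
  if odd b then top M q - (top M q / (q ^+ n + 1)) else (top M q / (q ^+ n + 1)).
  rewrite mulSnr IHb//; case: ifP => _; field => //.
elim: j jn => [|j IHj] jn.
  by rewrite addn0 base/=; case: odd; rewrite /= expr0 mul1r.
rewrite addnS/= IHj ?(ltnW jn)// /block divnMDl// (divn_small jn) addn0 /=.
by case: odd; rewrite /= exprS; lra.
Qed.

(** The third window bound is equivalent to the last inequality. The block value is [top M q] minus
    the same fraction, which is at most half of [top M q]. *)
Lemma block_value_bounds n q : block_window n q ->
  top M q - 1 < block_value n q < 1 /\
  top M q - 1 < top M q / (q ^+ n + 1).
Proof.
move=> [q1 qM hu _].
have K1 : 1 < top M q by apply: top_gt1; rewrite q1.
have u1 : 1 <= q ^+ n by apply: exprn_ege1; lra.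
have v : top M q - 1 < top M q / (q ^+ n + 1) by rewrite ltr_pdivlMr; lra.
have -> : block_value n q = top M q - top M q / (q ^+ n + 1).
  by rewrite /block_value; field; rewrite gt_eqF//; lra.
have h : top M q / (q ^+ n + 1) <= top M q / 2 by rewrite ler_pM2l ?lef_pV2 ?posrE; lra.
by split=> //; apply/andP; split; lra.
Qed.

End BlockSequences.
Arguments block_window {R} M n q.
Arguments block_value {R} M n q.

Arguments block M n k : clear implicits.

(** * Isolation of a base in the window *)

Section IsolatedBase.
Context {R : realType} {M : nat}.
Implicit Types (q x y : R) (e : nat -> 'I_M.+1).

(** Used backwards: a later remainder bounds an earlier one from below. [remainder_upper] is the
    reflected estimate. *)
Lemma remainder_lower q x e i j : 0 < q ->
  remainder q x e (i + j) <= q ^+ j * remainder q x e i.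
Proof.
move=> q0; elim: j => [|j IHj]; first by rewrite addn0 expr0 mul1r.
rewrite addnS/= exprS -mulrA; have := ler0n R (e (i + j)%N).
by rewrite -(ler_pM2l q0) in IHj; lra.
Qed.

Lemma remainder_upper q x e i j : 1 < q ->
  top M q - remainder q x e (i + j) <= q ^+ j * (top M q - remainder q x e i).
Proof.
move=> q1; have Km := topM (M := M) _ q1; elim: j => [|j IHj].
  by rewrite addn0 expr0 mul1r.
rewrite addnS/= exprS -mulrA; have := digit_le (R := R) e (i + j).
by rewrite -(ler_pM2l (x := q)) in IHj; lra.
Qed.

(** Going back at most [n] places from index [L.+1] divides the distances to 0 and to the top by at
    most [q ^+ n]. For the upper bound, the digit 0 at [L] makes [q] times the distance to the top
    there exceed 1, and the third window bound concludes. *)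
Lemma block_tail_prefix q y e L n i : (0 < M)%N -> (L < n)%N -> block_window M n q ->
  remainder q y (block_tail e L n) L.+1 = block_value M n q ->
  (i <= L.+1)%N ->
  top M q - 1 < remainder q y (block_tail e L n) i < 1.
Proof.
move=> M0 Ln gq rL iL.
have [/andP[t0 t1] v0] := block_value_bounds _ _ gq.
have [q1 qM hu _] := gq.
have K1 : 1 < top M q by apply: top_gt1; rewrite q1.
have Km := topM (M := M) _ q1.
move: iL; rewrite leq_eqVlt => /orP[/eqP->|]; first by rewrite rL t0 t1.
rewrite ltnS => iL.
set d := block_tail e L n in rL *; set r := remainder q y d i.
have u0 : 0 < q ^+ n by apply: exprn_gt0; lra.
have c1 : q ^+ (L.+1 - i) <= q ^+ n by rewrite ler_eXn2l//; lia.
have c0 : 1 <= q ^+ (L.+1 - i) by apply: exprn_ege1; lra.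
have low : block_value M n q <= q ^+ (L.+1 - i) * r.
  have := @remainder_lower q y d i (L.+1 - i) ltac:(lra).
  by rewrite subnKC ?rL// ltnW.
have upp : 1 < q ^+ (L.+1 - i) * (top M q - r).
  have := @remainder_upper q y d i (L - i) q1.
  rewrite subnKC// subSn// exprS -mulrA -/r -(ler_pM2l (x := q)); last lra.
  have : q * (top M q - remainder q y d L) = M%:R + (top M q - block_value M n q).
    have dL : d L = ord0 by rewrite /d /block_tail ltnn eqxx.
    by rewrite -rL /= dL/=; lra.
  have M1 : 1 <= M%:R :> R by rewrite ler1n.
  lra.
apply/andP; split.
  apply: (lt_le_trans v0).
  rewrite -(ler_pM2l u0).
  have -> : q ^+ n * (top M q / (q ^+ n + 1)) = block_value M n q.
    by rewrite /block_value; field; rewrite gt_eqF//; lra.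
  apply: (le_trans low); rewrite ler_wpM2r//.
  by rewrite -(pmulr_rge0 (x := q ^+ (L.+1 - i))); lra.
suff : top M q - 1 < top M q - r by lra.
rewrite -(ltr_pM2l u0); apply: (lt_trans hu); apply: (lt_le_trans upp).
rewrite ler_wpM2r//.
by rewrite -(pmulr_rge0 (x := q ^+ (L.+1 - i))); lra.
Qed.

Lemma block_tail_bounds q y e L n : (0 < M)%N -> (L < n)%N -> block_window M n q ->
  remainder q y (block_tail e L n) L.+1 = block_value M n q ->
  forall i, 0 <= remainder q y (block_tail e L n) i <= top M q /\
            univoque_digit q y (block_tail e L n) i.
Proof.
move=> M0 Ln gq rL i.
have n0 : (0 < n)%N by apply: leq_ltn_trans Ln.
have [_ v0] := block_value_bounds _ _ gq.
have [q1 qM hu _] := gq.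
have K1 : 1 < top M q by apply: top_gt1; rewrite q1.
set d := block_tail e L n in rL *.
have pre := fun i => @block_tail_prefix q y e L n i M0 Ln gq rL.
(* Up to index [L] both univoque bounds hold whatever the digit is, so nothing is asked of [e]. *)
have [iL|Li] := leqP i L.
  have /andP[a1 a2] := pre i (leqW iL); have /andP[b1 b2] := pre i.+1 iL.
  by split=> //; apply/andP; split; lra.
have tail k : remainder q y d (L.+1 + k) = remainder q (block_value M n q) (block M n) k.
  rewrite remainder_add rL; apply: remainder_eq => j _.
  rewrite /d /block_tail; case: ltnP => [|_]; first lia.
  by case: eqP => [|_]; [lia|rewrite addKn].
rewrite -(subnKC Li); set k := (i - L.+1)%N.
have dk : d (L.+1 + k)%N = block M n k.
  rewrite /d /block_tail; case: ltnP => [|_]; first lia.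
  by case: eqP => [|_]; [lia|rewrite addKn].
have jn := ltn_pmod k n0.
have u0 : 0 < q ^+ n by apply: exprn_gt0; lra.
have w j : (j <= n)%N ->
    top M q / (q ^+ n + 1) <= q ^+ j * (top M q / (q ^+ n + 1)) <=
    top M q - top M q / (q ^+ n + 1).
  move=> jn'.
  have v1 : 0 < top M q / (q ^+ n + 1) by lra.
  have -> : top M q - top M q / (q ^+ n + 1) = q ^+ n * (top M q / (q ^+ n + 1)).
    by field; rewrite gt_eqF//; lra.
  rewrite ler_pMl// ler_pM2r// ler_eXn2l// jn' andbT.
  by apply: exprn_ege1; exact: ltW.
have /andP[w1 w2] := w _ (ltnW jn); have /andP[w3 w4] := w _ jn.
rewrite /univoque_digit -addnS !tail dk /block.
have -> : k.+1 = (k %/ n * n + (k %% n).+1)%N by rewrite addnS -divn_eq.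
rewrite {1 2}(divn_eq k n) !block_remainder// ?(ltnW jn)//.
case: ifP => _ /=; (split; first by apply/andP; split; lra).
  by split=> // _; lra.
by rewrite ltnn; split=> // _; lra.
Qed.

(** For [q < q'] the difference [D] of the remainders satisfies [D i.+1 = q * D i + (q' - q) *
    remainder q' y e i], so it grows at least like [q ^+ i], yet it is bounded by [top M q']. *)
Lemma base_unique y e q q' : 0 < y -> 1 < q -> 1 < q' ->
  (forall i, 0 <= remainder q y e i <= top M q) ->
  (forall i, 0 <= remainder q' y e i <= top M q') -> q = q'.
Proof.
move=> y0.
wlog : q q' / q < q'.
  move=> H q1 q1' h h'; case: (ltgtP q q') => // qq; first exact: H.
  by apply/esym; exact: H.
move=> qq' q1 q1' h h'; exfalso.
pose D i := remainder q' y e i - remainder q y e i.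
have DS i : q ^+ i * ((q' - q) * y) <= D i.+1.
  elim: i => [|i IHi]; first by rewrite expr0 /D/=; lra.
  have /andP[r0 _] := h' i.+1.
  rewrite exprS -mulrA; apply: (@le_trans _ _ (q * D i.+1)).
    by rewrite ler_pM2l//; lra.
  rewrite {2}/D; move: IHi; rewrite /D.
  change (remainder q' y e i.+2) with (q' * remainder q' y e i.+1 - (e i.+1 : nat)%:R).
  change (remainder q y e i.+2) with (q * remainder q y e i.+1 - (e i.+1 : nat)%:R).
  move=> _; nra.
have c0 : 0 < (q' - q) * y by rewrite mulr_gt0// subr_gt0.
have [N /(_ N (leqnn N))] := @expr_unbounded R q (top M q' / ((q' - q) * y)) q1.
rewrite ltr_pdivrMr// ltNge => /negP; apply.
apply: (le_trans (DS N)); rewrite /D.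
have /andP[_ a] := h' N.+1; have /andP[b _] := h N.+1.
lra.
Qed.

Lemma top_continuous q : 1 < q -> top M q' @[q' --> q] --> top M q.
Proof.
move=> q1; apply: cvgM; first exact: cvg_cst.
apply: cvgV; first by rewrite gt_eqF// subr_gt0.
by apply: cvgB; [exact: cvg_id|exact: cvg_cst].
Qed.

Lemma remainder_continuous y e k q :
  remainder q' y e k @[q' --> q] --> remainder q y e k.
Proof.
elim: k => [|k IHk] /=; first exact: cvg_cst.
by apply: cvgB; [apply: cvgM => //; exact: cvg_id|exact: cvg_cst].
Qed.

Lemma near_block_window n q : block_window M n q ->
  \forall q' \near q, block_window M n q'.
Proof.
move=> [q1 qM h1 h2].
have ct := top_continuous q q1.
have cX : q' ^+ n @[q' --> q] --> q ^+ n by exact: exprn_continuous.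
have cX2 : (q' ^+ n) ^+ 2 @[q' --> q] --> (q ^+ n) ^+ 2.
  by rewrite !expr2; apply: cvgM.
have c1 : q' ^+ n * (top M q' - 1) @[q' --> q] --> q ^+ n * (top M q - 1).
  by apply: cvgM => //; apply: cvgB => //; exact: cvg_cst.
have c2 : (q' ^+ n) ^+ 2 * (top M q' - 1) - top M q' * (q' ^+ n - 1) @[q' --> q] -->
          (q ^+ n) ^+ 2 * (top M q - 1) - top M q * (q ^+ n - 1).
  by apply: cvgB; apply: cvgM => //; apply: cvgB => //; exact: cvg_cst.
have h2' : 0 < (q ^+ n) ^+ 2 * (top M q - 1) - top M q * (q ^+ n - 1) by lra.
near=> q'; split.
- by near: q'; exact: lt_nbhsr.
- by near: q'; exact: lt_nbhsl.
- by near: q'; exact: (cvgr_lt _ c1).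
- rewrite -subr_gt0; near: q'; exact: (cvgr_gt _ c2).
Unshelve. all: by end_near. Qed.

Lemma isolated_base q y e L n : (0 < M)%N -> (L < n)%N -> block_window M n q ->
  remainder q y (block_tail e L n) L.+1 = block_value M n q ->
  0 < y /\ isolated (univoque_bases M y) q.
Proof.
move=> M0 Ln gq rL.
have n0 : (0 < n)%N by apply: leq_ltn_trans Ln.
have bnd := @block_tail_bounds q y e L n M0 Ln gq rL.
have [q1 qM _ _] := gq.
have K1 : 1 < top M q by apply: top_gt1; rewrite q1.
set d := block_tail e L n in rL bnd *.
have y0 : 0 < y.
  have /andP[] := @block_tail_prefix q y e L n 0 M0 Ln gq rL isT.
  by rewrite /=; lra.
have Uq : univoque_bases M y q.
  split; first by rewrite q1 ltW.
  exists d; split; first by apply/q_expansionP => // i; case: (bnd i).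
  move=> f /q_expansionP -/(_ q1) fP; apply/funext => i; apply/esym.
  apply: (@expansion_prefix_unique R M q y d f i.+1) => // j _.
    by have [_ []] := bnd j.
  by have [_ []] := bnd j.
split=> //; split; first exact/mem_set.
(* [N] covers the prefix, the separating 0 and the first block M^n. *)
pose N := (L.+1 + n)%N.
(* These are finitely many strict inequalities between functions continuous in the base, so they
   persist near [q]. *)
exists [set q' | block_window M n q' /\ forall i : 'I_N, univoque_digit q' y d i].
  have near_bound i : \forall q' \near q, univoque_digit q' y d i.
    have [_ [b1 b2]] := bnd i.
    have cr := @remainder_continuous y d i.+1 q.
    have ct := top_continuous q q1.
    have : \forall q' \near q, (d i < M)%N -> remainder q' y d i.+1 < 1.
      have [/b1 lt|_] := boolP (d i < M)%N; last by near=> q'.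
      near=> q' => _; near: q'; exact: (cvgr_lt _ cr).
    have : \forall q' \near q, (0 < d i)%N -> top M q' - 1 < remainder q' y d i.+1.
      have [/b2 lt|_] := boolP (0 < d i)%N; last by near=> q'.
      have c2 : remainder q' y d i.+1 - (top M q' - 1) @[q' --> q] -->
                remainder q y d i.+1 - (top M q - 1).
        by apply: cvgB => //; apply: cvgB => //; exact: cvg_cst.
      near=> q' => _; rewrite -subr_gt0; near: q'; apply: (cvgr_gt _ c2).
      by rewrite subr_gt0.
    by move=> h2 h1; exact: filterI h1 h2.
  apply: filterI (near_block_window _ _ gq) _.
  exact: (@filter_forall R 'I_N (fun i q' => univoque_digit q' y d i)
    (nbhs q) _ near_bound).
apply/seteqP; split=> [q' [[gq' nb] [q'M [f [fy fU]]]]|_ ->]; last first.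
  by split=> //; split=> // i; case: (bnd i).
have [q1' qM' _ _] := gq'.
have fP := (q_expansionP _ _ _ q1').1 fy.
have fb := unique_univoque_digit _ _ _ q'M fy fU.
have pre i : (i < N)%N -> f i = d i.
  apply: expansion_prefix_unique q1' fP _ _ _ => j jN.
    exact: (nb (Ordinal jN)).1.
  exact: (nb (Ordinal jN)).2.
have dk k : d (L.+1 + k)%N = block M n k.
  rewrite /d /block_tail; case: ltnP => [|_]; first lia.
  by case: eqP => [|_]; [lia|rewrite addKn].
have forced : forall k, f (L.+1 + k)%N = block M n k.
  apply: (@block_forced R M q' y) => //.
    apply: (fb L).1; rewrite pre ?/N; last lia.
    by rewrite /d /block_tail ltnn eqxx.
  move=> j jn; rewrite pre; last by rewrite /N; lia.
  by rewrite dk /block divn_small.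
have fd : f = d.
  apply/funext => i; have [iN|iN] := ltnP i N; first exact: pre.
  have -> : i = (L.+1 + (i - L.+1))%N by rewrite subnKC//; rewrite /N in iN; lia.
  by rewrite forced dk.
apply/esym/(@base_unique y d) => // i; first by case: (bnd i).
by rewrite -fd; exact: fP.
Unshelve. all: by end_near. Qed.

End IsolatedBase.

(** * Continuity in the base and existence of a window *)

Lemma psum_continuous (R : realType) M (e : nat -> 'I_M.+1) k (q : R) : 0 < q ->
  psum q' e k @[q' --> q] --> psum q e k.
Proof.
move=> q0; elim: k => [|k IHk].
  by rewrite /psum big_geq// (_ : (fun _ => _) = cst 0) ?cvg_cst//;
    [exact: cvg_cst|apply/funext => ?; rewrite big_geq].
rewrite (_ : (fun _ => _) = fun q' => psum q' e k + (e k : nat)%:R / q' ^+ k.+1); last first.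
  by apply/funext => q'; rewrite /psum big_nat_recr.
rewrite [X in _ --> X](_ : _ = psum q e k + (e k : nat)%:R / q ^+ k.+1); last first.
  by rewrite /psum big_nat_recr.
apply: cvgD => //; apply: cvgM; first exact: cvg_cst.
by apply: cvgV; [rewrite expf_neq0// gt_eqF|exact: exprn_continuous].
Qed.

Lemma block_value_continuous (R : realType) M n (q : R) : 1 < q ->
  block_value M n q' @[q' --> q] --> block_value M n q.
Proof.
move=> q1; have cX : q' ^+ n @[q' --> q] --> q ^+ n by exact: exprn_continuous.
apply: cvgM; first by apply: cvgM => //; exact: top_continuous.
apply: cvgV; first by rewrite gt_eqF// ltr_wpDl// exprn_ge0//; lra.
by apply: cvgD => //; exact: cvg_cst.
Qed.

(* The window lies where (q^n) * (top M q - 1) is just below 1; it contains every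
   zero of 2 (top M q - 1) u^3 - 2 u^2 + 1, u = q^n. *)
Lemma block_window_exists (R : realType) (M n : nat) (p : R) : 1 < p < M.+1%:R ->
  (top M p - 1)^-1 < p ^+ n -> exists2 q : R, p <= q <= M.+1%:R & block_window M n q.
Proof.
move=> /andP[p1 pM] pn.
have tp : 1 < top M p by apply: top_gt1; rewrite p1.
(* With u = [q ^+ n], a zero of [F] means [(top M q - 1)] u = 1 - 1/(2u^2), slightly below 1. *)
pose F q : R := 2 * (top M q - 1) * (q ^+ n) ^+ 3 - 2 * (q ^+ n) ^+ 2 + 1.
have cF : {within `[p, M.+1%:R], continuous F}.
  apply: continuous_in_subspaceT => q /set_mem; rewrite /= in_itv/= => /andP[pq _].
  have cX : q' ^+ n @[q' --> q] --> q ^+ n by exact: exprn_continuous.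
  have cXk k : (q' ^+ n) ^+ k @[q' --> q] --> (q ^+ n) ^+ k.
    exact: cvg_comp cX (@exprn_continuous R k (q ^+ n)).
  have ct := @top_continuous R M q (lt_le_trans p1 pq).
  apply: cvgD; last exact: cvg_cst.
  apply: cvgB; apply: cvgM => //; try exact: cvg_cst.
  by apply: cvgM; [exact: cvg_cst|apply: cvgB => //; exact: cvg_cst].
have Fp : 0 < F p.
  have u1 : 1 <= p ^+ n by apply: exprn_ege1; lra.
  have : 1 < (top M p - 1) * p ^+ n.
    by rewrite mulrC -ltr_pdivrMr ?div1r//; lra.
  rewrite /F; set u := p ^+ n; set k := top M p - 1 => ku.
  have : 0 <= u ^+ 2 * (k * u - 1) by rewrite mulr_ge0 ?sqr_ge0//; lra.
  by nra.
have topM1 : (0 < M)%N -> top M M.+1%:R = 1 :> R.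
  by move=> M0; rewrite /top -natr1 addrK divff// pnatr_eq0 -lt0n.
have M0 : (0 < M)%N.
  by rewrite lt0n; apply/negP => /eqP M0; move: pM; rewrite M0; lra.
have FM : F M.+1%:R < 0.
  rewrite /F topM1// subrr mulr0 mul0r sub0r.
  have u1 : 1 <= (M.+1%:R : R) ^+ n by apply: exprn_ege1; rewrite ler1n.
  rewrite expr2; nra.
have [q + Fq] : exists2 q : R, q \in `[p, M.+1%:R] & F q = 0.
  apply: IVT (ltW pM) cF _.
  by rewrite ge_min (ltW FM) orbT/= le_max (ltW Fp).
rewrite in_itv/= => /andP[pq qM]; exists q; first by rewrite pq.
have q1 : 1 < q by lra.
have {}qM : q < M.+1%:R.
  rewrite lt_neqAle qM andbT; apply: contraTneq FM => <-.
  by rewrite Fq ltxx.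
have t1 : 1 < top M q by apply: top_gt1; rewrite q1.
have u1 : 1 <= q ^+ n by apply: exprn_ege1; lra.
split => //.
  move: Fq; rewrite /F; set u := q ^+ n in u1 *; set k := top M q - 1 => Fq.
  have u2 : 0 < u ^+ 2 by rewrite exprn_gt0//; lra.
  rewrite -(ltr_pM2l u2) mulr1.
  have -> : u ^+ 2 * (u * k) = k * u ^+ 3 by ring.
  lra.
move: Fq; rewrite /F; set u := q ^+ n in u1 *.
have -> : top M q = (top M q - 1) + 1 by ring.
set k := top M q - 1 => Fq.
have u3 : 0 < u ^+ 3 by rewrite exprn_gt0//; lra.
(* Multiplying by u^3 allows substituting [2 * k * u ^+ 3 = 2 * u ^+ 2 - 1], which leaves (u^2 + u -
   1)/2 > 0. *)
rewrite -subr_gt0 -(pmulr_rgt0 _ u3).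
have -> : u ^+ 3 * (u ^+ 2 * (k + 1 - 1) - (k + 1) * (u - 1)) =
  (2 * k * u ^+ 3) / 2 * (u ^+ 2 - u + 1) - u ^+ 3 * (u - 1) by field.
have -> : 2 * k * u ^+ 3 = 2 * u ^+ 2 - 1 by lra.
have -> : (2 * u ^+ 2 - 1) / 2 * (u ^+ 2 - u + 1) - u ^+ 3 * (u - 1) =
  (u ^+ 2 + u - 1) / 2 by field.
by rewrite divr_gt0//; rewrite expr2; nra.
Qed.

(** * An interval of values near [x] *)

Lemma psum_block_tail (R : realType) M (e : nat -> 'I_M.+1) L n (q : R) :
  psum q (block_tail e L n) L.+1 = psum q e L.
Proof.
rewrite /psum big_nat_recr//= {2}/block_tail ltnn eqxx mul0r addr0.
by apply: eq_big_nat => i /andP[_ iL]; rewrite /block_tail iL.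
Qed.

Theorem lemma5p2 (R : realType) (M : nat) (hM : (1 <= M)%N)
    (x delta : R) (hx : 0 <= x <= 1) (hdelta : 0 < delta) :
  exists a b : R, a < b /\
    `]a, b[ `<=` X_iso R M `&` `]x - delta, x + delta[.
Proof.
pose b : R := M.+1%:R.
have M1 : 1 <= M%:R :> R by rewrite ler1n.
have b1 : 1 < b by rewrite /b -natr1; lra.
have topb : top M b = 1 by rewrite /top /b -natr1 addrK divff// pnatr_eq0 -lt0n.
have [e eP] : exists e : nat -> 'I_M.+1, forall n, 0 <= remainder b x e n <= top M b.
  by apply: expansion_exists; rewrite ?topb// b1/= lexx.
(* The error [delta] is split in three: the tail of [x] after [L] digits in base [b], the change of
   base in the prefix, and the tail in the new base. *)
have [L /(_ L (leqnn L)) bL] := @expr_unbounded R b (3 / delta) b1.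
have close : \forall q \near b,
    [/\ 1 < q, 3 / delta < q ^+ L & `|psum b e L - psum q e L| < delta / 3].
  have cL : q ^+ L @[q --> b] --> b ^+ L by exact: exprn_continuous.
  have cp : psum q e L @[q --> b] --> psum b e L by apply: psum_continuous; lra.
  have d3 : 0 < delta / 3 by lra.
  have cd := (cvgrPdist_lt _ _).1 cp _ d3.
  near=> q; split.
  - by near: q; exact: lt_nbhsr.
  - by near: q; exact: (cvgr_gt _ cL).
  - by near: q; exact: cd.
have [r /= r0 rP] := (nbhs_ballP _ _).1 close.
pose p := b - r / 2.
have cP (q : R) : p <= q <= b ->
    [/\ 1 < q, 3 / delta < q ^+ L & `|psum b e L - psum q e L| < delta / 3].
  move=> /andP[pq qb]; apply: rP; rewrite /ball/= ger0_norm; rewrite /p in pq; lra.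
have [p1 _ _] : _ := cP p ltac:(by rewrite lexx /p /=; lra).
have tp : 1 < top M p by apply: top_gt1; rewrite p1 /p/=; rewrite /b in r0 *; lra.
have [N NP] := @expr_unbounded R p (top M p - 1)^-1 p1.
(* Large enough both for a window above [p] and for a prefix shorter than a block. *)
pose n := (N + L.+1)%N.
have Ln : (L < n)%N by rewrite /n; lia.
have [q0 q0P gq0] : exists2 q : R, p <= q <= b & block_window M n q.
  apply: block_window_exists; first by rewrite p1 /p/= -/b; lra.
  by apply: NP; rewrite /n; lia.
(* The value of [block_tail e L n] in base [q], in closed form. *)
pose g (q : R) : R := psum q e L + block_value M n q / q ^+ L.+1.
have gc (q : R) : 1 < q -> {for q, continuous g}.
  move=> q1; apply: cvgD; first by apply: psum_continuous; lra.
  apply: cvgM; first exact: block_value_continuous.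
  by apply: cvgV; [rewrite expf_neq0// gt_eqF//; lra|exact: exprn_continuous].
have grem (q : R) : 1 < q ->
    remainder q (g q) (block_tail e L n) L.+1 = block_value M n q.
  move=> q1; have q0' : q != 0 by rewrite gt_eqF//; lra.
  rewrite remainderE// psum_block_tail /g addrAC subrr add0r.
  by field; rewrite expf_neq0.
have gx : `|x - g q0| < delta.
  have [c1 c2 c3] := cP _ q0P.
  have bL0 : 0 < b ^+ L by apply: exprn_gt0; lra.
  have qL0 : 0 < q0 ^+ L by apply: exprn_gt0; lra.
  have inv3 u : 0 < u -> 3 / delta < u -> u^-1 < delta / 3.
    move=> u0 h; rewrite -[delta / 3]invrK ltf_pV2 ?posrE ?invr_gt0 ?divr_gt0//.
    by rewrite invf_div.
  have h1 := inv3 _ bL0 bL; have h2 := inv3 _ qL0 c2.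
  have /andP[v0 v1] := (block_value_bounds _ _ gq0).1.
  have t1 : 1 < top M q0 by case: gq0 => ? ? _ _; apply: top_gt1; apply/andP.
  have /andP[s0 s1] : 0 <= block_value M n q0 / q0 ^+ L.+1 <= (q0 ^+ L)^-1.
    apply/andP; split; first by rewrite divr_ge0 ?exprn_ge0//; lra.
    rewrite exprS invfM mulrA ler_piMl ?invr_ge0 ?ltW//.
    by rewrite ltr_pdivrMr; lra.
  have xb : x - psum b e L = remainder b x e L / b ^+ L.
    by rewrite (@psumE _ _ _ x) ?subKr// gt_eqF//; lra.
  have := eP L; rewrite topb => /andP[rL0 rL1].
  have /andP[t2 t3] : 0 <= x - psum b e L <= (b ^+ L)^-1.
    have bL0' := ltW bL0; rewrite xb; apply/andP; split; first exact: divr_ge0.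
    by rewrite ler_piMl ?invr_ge0.
  move: c3; rewrite !ltr_norml /g => /andP[? ?]; apply/andP; split; lra.
have near_q0 : \forall q \near q0, block_window M n q /\ `|x - g q| < delta.
  have q01 : 1 < q0 by case: gq0.
  have cgx : `|x - g q| @[q --> q0] --> `|x - g q0|.
    by apply: cvg_norm; apply: cvgB; [exact: cvg_cst|exact: gc].
  by apply: filterI; [exact: near_block_window|exact: (cvgr_lt _ cgx)].
have [s /= s0 sP] := (nbhs_ballP _ _).1 near_q0.
pose q1 := q0 + s / 2.
have q01P (q : R) : q0 <= q <= q1 -> block_window M n q /\ `|x - g q| < delta.
  move=> /andP[h1 h2]; apply: sP; rewrite /ball/= ler0_norm; rewrite /q1 in h2; lra.
have gt1 q : q0 <= q <= q1 -> 1 < q by move=> /q01P[[]].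
have q01 : q0 < q1 by rewrite /q1; lra.
have h0 : q0 <= q0 <= q1 by rewrite lexx ltW.
have h1 : q0 <= q1 <= q1 by rewrite lexx ltW.
have bnd q (h : q0 <= q <= q1) := @block_tail_bounds R M q (g q) e L n hM Ln
  (q01P q h).1 (grem q (gt1 q h)).
have gne : g q0 != g q1.
  apply/eqP => gg.
  have [y0 _] := isolated_base q0 (g q0) e L n hM Ln gq0 (grem _ (gt1 _ h0)).
  suff : q0 = q1 by lra.
  apply: (base_unique (g q0) (block_tail e L n)) (gt1 _ h0) (gt1 _ h1) _ _ => // i.
    by case: (bnd _ h0 i).
  by rewrite gg; case: (bnd _ h1 i).
(* The proof establishes only [g q0 != g q1], not which is larger; the intermediate value theorem
   fills the gap between them. *)
exists (Num.min (g q0) (g q1)), (Num.max (g q0) (g q1)); split.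
  by rewrite gt_min !lt_max !ltxx orbF -neq_lt.
move=> y; rewrite /= in_itv/= => /andP[y1 y2].
have [q + gqy] : exists2 q : R, q \in `[q0, q1] & g q = y.
  apply: IVT (ltW q01) _ _; last by rewrite !ltW.
  apply: continuous_in_subspaceT => q /set_mem; rewrite /= in_itv/= => h.
  exact/gc/gt1.
rewrite in_itv/= => h; rewrite -gqy; have [gq gd] := q01P _ h.
have [y0 iso] := isolated_base q (g q) e L n hM Ln gq (grem _ (gt1 _ h)).
split; first by split=> //; exists q.
by move: gd; rewrite /= in_itv/= ltr_norml => /andP[? ?]; apply/andP; split; lra.
Unshelve. all: by end_near. Qed.
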